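(* Let $A,B,C,D$ be positive integers such that $A<B<C<D$ and $C-A=D-B$. Let $a=A/2$, $b=B/2$, $c=C/2$, $d=D/2$, and suppose that exactly two of $a,b,c,d$ are integers, so that the billiard table with successive corners at $a,b,c,d$ has exactly two corner pockets. Then the $45$ degree path between the two pockets touches all of the integer points along the perimeter of the table if and only if the double-sides $B-A$ and $C-B$ of the rectangle are relatively prime.
   Context: The billiard table with successive corners at $a<b<c<d$ (where $c-a=d-b$) is a rectangle whose boundary is parametrized by arc length with coordinates taken modulo the perimeter $P=2(c-a)=2(d-b)=C-A=D-B$; going once around the boundary in the direction of increasing coordinate, the four corners are met at coordinates $a,b,c,d$ in this order. Its side lengths are thus $b-a=d-c$ and $c-b\equiv a-d \pmod P$; twice the side lengths, $B-A$ and $C-B$, are called the double-sides. The integer points along the perimeter are the $P$ boundary points whose coordinate is an integer mod $P$. A pocket is a corner whose coordinate is an integer. The billiard ball travels in straight lines making a $45$ degree angle with the sides, and reflects (angle of incidence equal to angle of reflection) at each non-corner boundary point it hits; it starts at a pocket, leaving along the bisector of the right angle there, and stops on reaching a pocket. (When there are exactly two pockets, the path started at one of them ends at the other; this is the $45$ degree path between the pockets.) Equivalently, a boundary point with coordinate $x$ is joined by $45$ degree segments to the boundary points with coordinates $A-x$ and $B-x$ modulo $P$ (where $A\equiv C$ and $B\equiv D$ modulo $P$). The path touches a boundary point if it starts, bounces, or ends there. *)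

(* Defs.v *)
From HB Require Import structures.
From mathcomp Require Import all_boot all_order all_algebra.
From mathcomp Require Import reals.

Set Implicit Arguments.
Unset Strict Implicit.
Unset Printing Implicit Defensive.

Import Order.TTheory GRing.Theory Num.Theory.
Local Open Scope ring_scope.

(* The arc-length coordinates of the four successive corners. The table is
   placed in the plane as the rectangle [0, width] x [0, height], with corner_a
   at the origin and coordinates increasing counterclockwise. *)
Record table (R : realType) := Table {
  corner_a : R; corner_b : R; corner_c : R; corner_d : R }.

Definition corners (R : realType) (T : table R) : seq R :=
  [:: corner_a T; corner_b T; corner_c T; corner_d T].

Definition width (R : realType) (T : table R) : R := corner_b T - corner_a T.
Definition height (R : realType) (T : table R) : R := corner_c T - corner_b T.
Definition perimeter (R : realType) (T : table R) : R :=
  2 * (corner_c T - corner_a T).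

(* The representative of t modulo the perimeter in [a, a + perimeter). *)
Definition reduce (R : realType) (T : table R) (t : R) : R :=
  t - (Num.floor ((t - corner_a T) / perimeter T))%:~R * perimeter T.

(* The boundary point with coordinate t modulo the perimeter. *)
Definition boundary_point (R : realType) (T : table R) (t : R) : R * R :=
  let s := reduce T t in
  if s <= corner_b T then (s - corner_a T, 0)
  else if s <= corner_c T then (width T, s - corner_b T)
  else if s <= corner_d T then (width T - (s - corner_c T), height T)
  else (0, height T - (s - corner_d T)).

Definition integer_point (R : realType) (T : table R) (q : R * R) : Prop :=
  exists n : int, q = boundary_point T n%:~R.

Definition is_corner (R : realType) (T : table R) (q : R * R) : Prop :=
  exists2 t, t \in corners T & q = boundary_point T t.

Definition pocket (R : realType) (T : table R) (q : R * R) : Prop :=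
  exists t, [/\ t \in corners T, t \is a Num.int & q = boundary_point T t].

Definition interior (R : realType) (T : table R) (q : R * R) : bool :=
  (0 < q.1 < width T) && (0 < q.2 < height T).

Definition on_vertical_side (R : realType) (T : table R) (q : R * R) : bool :=
  ((q.1 == 0) || (q.1 == width T)) && (0 <= q.2 <= height T).

Definition on_horizontal_side (R : realType) (T : table R) (q : R * R) : bool :=
  (0 <= q.1 <= width T) && ((q.2 == 0) || (q.2 == height T)).

Definition on_boundary (R : realType) (T : table R) (q : R * R) : bool :=
  on_vertical_side T q || on_horizontal_side T q.

Definition move (R : realType) (p v : R * R) (t : R) : R * R :=
  (p.1 + t * v.1, p.2 + t * v.2).

(* q is the first boundary point hit by the ball leaving p with velocity v. *)
Definition hits (R : realType) (T : table R) (p v q : R * R) : Prop :=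
  exists t : R, [/\ 0 < t, q = move p v t, on_boundary T q
    & forall s : R, 0 < s < t -> interior T (move p v s)].

(* Only meaningful at corners: the velocity, with entries 1 or -1, that points
   into the table along the bisector of the right angle. *)
Definition bisector (R : realType) (q : R * R) : R * R :=
  (if q.1 == 0 then 1 else -1, if q.2 == 0 then 1 else -1).

(* Only meaningful at non-corner boundary points. *)
Definition reflect_velocity (R : realType) (T : table R) (q v : R * R) : R * R :=
  if on_vertical_side T q then (- v.1, v.2) else (v.1, - v.2).

(* ball T u p v: the ball started at u leaves the boundary point p with
   velocity v at some moment. There is no constructor for leaving a corner
   other than the start: the ball stops at a pocket, and when it starts at a
   pocket of a table whose double-sides are integers it only hits integer
   points, hence never a corner that is not a pocket. *)
Inductive ball (R : realType) (T : table R) (u : R * R) :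
    R * R -> R * R -> Prop :=
| ball_start : ball T u u (bisector u)
| ball_bounce p v q :
    ball T u p v -> hits T p v q -> ~ is_corner T q ->
    ball T u q (reflect_velocity T q v).

(* The path started at u starts, bounces or ends at q. *)
Definition touches (R : realType) (T : table R) (u q : R * R) : Prop :=
  q = u \/ exists p v, ball T u p v /\ hits T p v q.

(* Main.v *)
(** Doubling all lengths turns the table into [[0, m] x [0, n]] with
    [m = B - A] and [n = C - B]; every boundary point [(X, Y)] with integer
    coordinates is at arc length congruent to [X + Y] modulo 2 from [a], and it
    comes from an integer point exactly when [X + Y] has the parity of [A].

    If the path touches all integer points, let [g] be the gcd of [m] and [n],
    which is odd because there are exactly two pockets. Both coordinates of all
    touched points are multiples of [g], so the integer point that follows the
    starting pocket, at doubled distance 2, forces [g] to divide 2.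

    Conversely, unfolding the reflections, the ball started at
    [(x0, y0) = (e m, f n)] is at time [s] at the point whose coordinates are
    the triangle waves of [x0 + s] and [y0 + s], and for coprime [m], [n] it
    meets no corner at times strictly between [0] and [m n]. Given an integer
    point [(X, Y)], the congruences [T = X - x0] mod [2 m] and [T = Y - y0] mod
    [2 n] are compatible modulo 2, hence have a solution with [|T| <= m n].
    Triangle waves being even, the ball is at [(X, Y)] at time [|T|]. *)

Require Import Defs.
From HB Require Import structures.
From mathcomp Require Import all_boot all_order all_algebra.
From mathcomp Require Import reals zify ring lra.

Set Implicit Arguments.
Unset Strict Implicit.
Unset Printing Implicit Defensive.

Import Order.TTheory GRing.Theory Num.Theory.
Local Open Scope ring_scope.

(** * Triangle waves and their congruences *)

(* The triangle wave of period 2 m, with range [0, m], evaluated at s + e m. *)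
Definition fold (m : nat) (e : bool) (s : nat) : nat :=
  if odd (s %/ m + e) then (m - s %% m)%N else (s %% m)%N.

Lemma fold_le (m : nat) (e : bool) (s : nat) : (0 < m)%N -> (fold m e s <= m)%N.
Proof.
move=> m0; rewrite /fold; have := ltn_pmod s m0.
by case: odd => /ltnW// _; rewrite leq_subr.
Qed.

Lemma fold0 (m : nat) (e : bool) : fold m e 0 = (e * m)%N.
Proof. by rewrite /fold div0n mod0n; case: e; rewrite ?mul1n ?mul0n ?subn0. Qed.

Lemma fold_mul (m k : nat) (e : bool) : (0 < m)%N ->
  fold m e (k * m) = (odd (k + e) * m)%N.
Proof. by move=> m0; rewrite /fold mulnK// modnMl subn0; case: odd; rewrite ?mul1n. Qed.

Lemma fold_ndvd (m : nat) (e : bool) (s : nat) : (0 < m)%N -> ~~ (m %| s)%N ->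
  (0 < fold m e s < m)%N.
Proof.
move=> m0; rewrite /dvdn -lt0n /fold => r0; have := ltn_pmod s m0.
case: odd; lia.
Qed.

(** The end [r = m] is allowed: there the quotient advances and the parity flips, so the end of one
    branch agrees with the start of the next. *)
Lemma fold_linear (m i r : nat) (e : bool) : (0 < m)%N -> (r <= m)%N ->
  fold m e (i * m + r) = if odd (i + e) then (m - r)%N else r.
Proof.
move=> m0; rewrite leq_eqVlt => /orP[/eqP->|rm].
  have -> : (i * m + m = i.+1 * m)%N by rewrite mulSn addnC.
  by rewrite fold_mul// addSn /=; case: odd; rewrite ?subnn ?mul1n.
by rewrite /fold divnMDl// divn_small// addn0 modnMDl modn_small.
Qed.

(** The wave is even and [2 * m]-periodic in [s + e * m], and the shifts by [e * m] and [- (e * m)]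
    agree modulo [2 * m]. *)
Lemma fold_congr (m X : nat) (e : bool) (s : nat) (k : int) : (0 < m)%N ->
  (X <= m)%N -> (s%:Z = X%:Z - (e * m)%:Z + (2 * m)%:Z * k) \/
    (s%:Z = - (X%:Z - (e * m)%:Z) + (2 * m)%:Z * k) -> fold m e s = X.
Proof.
move=> m0 Xm sE.
have shift : fold m e s = fold m false (s + e * m).
  by rewrite /fold addn0 addnC (addnC s) divnMDl// modnMDl.
rewrite shift.
have [l [lE|lE]] : exists l : nat, (s + e * m = (2 * l) * m + X)%N \/
    (s + e * m + X = (2 * l) * m)%N.
  case: sE => sE.
  - have k0 : 0 <= k by case: (e) (sE) => sE'; nia.
    by exists `|k|%N; left; nia.
  - have k0 : 0 <= k + (e : nat)%:Z by case: (e) (sE) => sE'; nia.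
    by exists (absz (k + (e : nat)%:Z)); right; nia.
- by rewrite lE fold_linear// addn0 oddM.
- case: l lE => [|l] lE.
    have [-> ->] : (s + e * m = 0 /\ X = 0)%N by lia.
    exact: fold0.
  (* The residue [- X] lies at offset [m - X] in an odd block, where the wave descends. *)
  have -> : (s + e * m = (2 * l).+1 * m + (m - X))%N by lia.
  rewrite fold_linear ?leq_subr//= addn0 oddM /=; lia.
Qed.

Lemma fold_chinese (m n X Y : nat) (e f : bool) : (0 < m)%N -> (0 < n)%N ->
  coprime m n -> (X <= m)%N -> (Y <= n)%N ->
  odd (X + Y) = odd (e * m + f * n) ->
  exists2 s, (s <= m * n)%N & fold m e s = X /\ fold n f s = Y.
Proof.
move=> m0 n0 cop Xm Yn par.
have [a [b ab]] : exists a b : int, a * m%:Z + b * n%:Z = 1.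
  by have /coprimezP[[a b] /= ab] : coprimez m%:Z n%:Z by []; exists a, b.
(* The parity hypothesis makes the gap between the two residues even, as the moduli [2 * m] and
   [2 * n] require. *)
have [h hE] : exists h : int,
    (Y%:Z - (f * n)%:Z) - (X%:Z - (e * m)%:Z) = 2 * h.
  exists ((((Y%:Z - (f * n)%:Z) - (X%:Z - (e * m)%:Z)) %/ 2)%Z); lia.
pose T0 := X%:Z - (e * m)%:Z + (2 * m)%:Z * (a * h).
(* Removing [q] common periods [2 * (m * n)] centers the solution around 0. *)
pose q := ((T0 + (m * n)%:Z) %/ (2 * (m * n))%:Z)%Z.
pose T := T0 - q * (2 * (m * n))%:Z.
have T0E : T0 = Y%:Z - (f * n)%:Z + (2 * n)%:Z * (- b * h).
  by rewrite /T0; nia.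
have Tle : (`|T| <= m * n)%N.
  have mn0 : (0 < m * n)%N by rewrite muln_gt0 m0.
  rewrite /T /q; lia.
have sx : T = X%:Z - (e * m)%:Z + (2 * m)%:Z * (a * h - q * n%:Z).
  by rewrite /T /T0 !PoszM; ring.
have sy : T = Y%:Z - (f * n)%:Z + (2 * n)%:Z * (- b * h - q * m%:Z).
  by rewrite /T T0E !PoszM; ring.
exists `|T|%N => //.
have [T_ge|T_lt] := lerP 0 T; split.
- by apply: fold_congr => //; left; rewrite gez0_abs//; exact: sx.
- by apply: fold_congr => //; left; rewrite gez0_abs//; exact: sy.
- apply: (@fold_congr _ _ _ _ (- (a * h - q * n%:Z))) => //; right.
  by rewrite ltz0_abs// {1}sx; ring.
- apply: (@fold_congr _ _ _ _ (- (- b * h - q * m%:Z))) => //; right.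
  by rewrite ltz0_abs// {1}sy; ring.
Qed.

(** * The table in doubled integer coordinates *)

(* Natural numbers stand for doubled lengths: m and n are the double-sides. *)
Definition half_table (R : realType) (A m n : nat) : table R :=
  Table (A%:R / 2) ((A + m)%:R / 2) ((A + m + n)%:R / 2) ((A + m + n + m)%:R / 2).

Definition half_point (R : realType) (p : nat * nat) : R * R :=
  (p.1%:R / 2, p.2%:R / 2).

(** [true] encodes the decreasing direction, so the bisector at the corner [(e * m, f * n)] is the
    heading with the same two flags. *)
Definition heading (R : realType) (e f : bool) : R * R :=
  ((-1) ^+ e, (-1) ^+ f).

(* The doubled point at doubled arc length r < 2 (m + n) from corner_a. *)
Definition perimeter_point (m n r : nat) : nat * nat :=
  if (r <= m)%N then (r, 0%N)
  else if (r <= m + n)%N then (m, (r - m)%N)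
  else if (r <= m + n + m)%N then ((m + n + m - r)%N, n)
  else (0%N, (2 * (m + n) - r)%N).

Lemma half_point_inj (R : realType) : injective (@half_point R).
Proof.
move=> [X Y] [X' Y'] [/= eX eY].
by congr pair; apply/eqP; rewrite -(eqr_nat R); apply/eqP; lra.
Qed.

Lemma width_half_table (R : realType) (A m n : nat) :
  width (half_table R A m n) = m%:R / 2.
Proof. by rewrite /width /= natrD; lra. Qed.

Lemma height_half_table (R : realType) (A m n : nat) :
  height (half_table R A m n) = n%:R / 2.
Proof. by rewrite /height /= !natrD; lra. Qed.

(** Half-integer coordinates cover both the integer points, where [z] is even, and the corners. *)
Lemma boundary_point_half (R : realType) (A m n : nat) (z : int) :
  (0 < m)%N -> (0 < n)%N ->
  boundary_point (half_table R A m n) (z%:~R / 2) =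
  half_point R (perimeter_point m n `|((z - A%:Z) %% (2 * (m + n))%:Z)%Z|%N).
Proof.
move=> m0 n0; set r := `|_|%N.
(* [k] is the floor in [reduce], the number of full turns removed. *)
pose k := ((z - A%:Z) %/ (2 * (m + n))%:Z)%Z.
have r_lt : (r < 2 * (m + n))%N by rewrite /r; lia.
have zE : z = A%:Z + r%:Z + k * (2 * (m + n))%:Z by rewrite /r /k; lia.
have mR : (0 : R) < m%:R by rewrite ltr0n.
have nR : (0 : R) < n%:R by rewrite ltr0n.
have zR : z%:~R = A%:R + r%:R + k%:~R * (2 * (m%:R + n%:R)) :> R.
  by rewrite zE !intrD intrM -!pmulrn natrM natrD.
have rR : r%:R < 2 * (m%:R + n%:R) :> R by rewrite -natrD -natrM ltr_nat.
have sE : reduce (half_table R A m n) (z%:~R / 2) = (A%:R + r%:R) / 2.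
  rewrite /reduce /perimeter /= (@floor_def _ _ k); first by rewrite zR !natrD; lra.
  rewrite !natrD ler_pdivlMr ?ltr_pdivrMr; [|lra|lra].
  have r0 : (0 : R) <= r%:R by [].
  by rewrite zR intrD; apply/andP; split; lra.
rewrite /boundary_point sE width_half_table height_half_table /=.
rewrite /perimeter_point -(ler_nat R r m) -(ler_nat R r (m + n)) -(ler_nat R r (m + n + m)) !natrD.
have -> : ((A%:R + r%:R) / 2 <= (A%:R + m%:R) / 2 :> R) = (r%:R <= m%:R :> R).
  by apply/idP/idP; lra.
have -> : ((A%:R + r%:R) / 2 <= (A%:R + m%:R + n%:R) / 2 :> R)
    = (r%:R <= m%:R + n%:R :> R).
  by apply/idP/idP; lra.
have -> : ((A%:R + r%:R) / 2 <= (A%:R + m%:R + n%:R + m%:R) / 2 :> R)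
    = (r%:R <= m%:R + n%:R + m%:R :> R).
  by apply/idP/idP; lra.
rewrite /half_point.
case: ifPn => [h|h1]; first by congr pair => /=; lra.
case: ifPn => [h|h2] /=.
  rewrite natrB; last by rewrite -(ler_nat R); lra.
  by congr pair; lra.
case: ifPn => [h|h3] /=.
  rewrite natrB; last by rewrite -(ler_nat R) !natrD.
  by rewrite !natrD; congr pair; lra.
rewrite natrB; last exact: ltnW.
by rewrite natrM natrD; congr pair; lra.
Qed.

Lemma perimeter_point_le (m n r : nat) : (r <= 2 * (m + n))%N ->
  ((perimeter_point m n r).1 <= m)%N /\ ((perimeter_point m n r).2 <= n)%N.
Proof. by rewrite /perimeter_point => r_le; do 3?[case: ifP => /=]; lia. Qed.

Lemma perimeter_point_side (m n r : nat) :
  [|| (perimeter_point m n r).1 == 0, (perimeter_point m n r).1 == m,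
      (perimeter_point m n r).2 == 0 | (perimeter_point m n r).2 == n]%N.
Proof. by rewrite /perimeter_point; do 3?[case: ifP => /=]; lia. Qed.

Lemma odd_perimeter_point (m n r : nat) : (r <= 2 * (m + n))%N ->
  odd ((perimeter_point m n r).1 + (perimeter_point m n r).2) = odd r.
Proof. by rewrite /perimeter_point => r_le; do 3?[case: ifP => /=]; lia. Qed.

(** On each side, [r] is up to sign one of the coordinates plus an integer combination of [m] and
    [n]. *)
Lemma dvdn_perimeter_point (m n r g : nat) : (r <= 2 * (m + n))%N ->
  (g %| m)%N -> (g %| n)%N -> (g %| (perimeter_point m n r).1)%N ->
  (g %| (perimeter_point m n r).2)%N -> (g %| r)%N.
Proof.
rewrite /perimeter_point => r_le gm gn.
have gmn : (g %| m + n)%N by rewrite dvdn_add.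
case: ifP => [//|/negbT h1]; case: ifP => [/= _ _|/negbT h2].
  by rewrite dvdn_subl// ltnW// ltnNge.
case: ifP => [/= h3 + _|/= /negbT h3 _]; first by rewrite dvdn_subr// ?dvdn_add// .
by rewrite dvdn_subr// dvdn_mull.
Qed.

Lemma perimeter_point_corner (m n : nat) : (0 < m)%N -> (0 < n)%N ->
  [/\ perimeter_point m n 0 = (0, 0), perimeter_point m n m = (m, 0),
      perimeter_point m n (m + n) = (m, n)
    & perimeter_point m n (m + n + m) = (0, n)]%N.
Proof.
move=> m0 n0; split; rewrite /perimeter_point.
- by [].
- by rewrite leqnn.
- by case: ifP => [|_]; [lia|rewrite leqnn; congr pair; lia].
- by do 2![case: ifP => [|_]; first lia]; rewrite leqnn; congr pair; lia.
Qed.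

(** [r] is the doubled arc length from [corner_a]. For the starting pocket, its divisibility serves
    the direct implication and its parity the converse. *)
Lemma corner_half_table (R : realType) (A m n : nat) (t : R) :
  (0 < m)%N -> (0 < n)%N -> t \in corners (half_table R A m n) ->
  exists (e f : bool) (r : nat), [/\ t = (A + r)%:R / 2,
    boundary_point (half_table R A m n) t = half_point R (e * m, f * n)%N,
    odd r = odd (e * m + f * n) & forall g, (g %| m -> g %| n -> g %| r)%N].
Proof.
move=> m0 n0; have [p0 p1 p2 p3] := perimeter_point_corner m0 n0.
have bpE r : (r < 2 * (m + n))%N ->
    boundary_point (half_table R A m n) ((A + r)%:R / 2) =
    half_point R (perimeter_point m n r).
  move=> r_lt; rewrite pmulrn boundary_point_half//.
  by rewrite PoszD addrC addKr modz_nat modn_small.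
rewrite /corners !inE /= => /or4P[]/eqP->.
- exists false, false, 0%N; split=> [|||g]; rewrite ?addn0//.
  by have := @bpE 0%N; rewrite addn0 p0 => ->//; lia.
- exists true, false, m; split=> //; rewrite ?mul1n ?mul0n ?addn0//.
  by rewrite bpE ?p1//; lia.
- exists true, true, (m + n)%N.
  split=> [|||g gm gn]; rewrite ?addnA ?mul1n ?dvdn_add//; last lia.
  by have := @bpE (m + n)%N; rewrite addnA p2 => ->//; lia.
- exists false, true, (m + n + m)%N.
  split=> [|||g gm gn]; rewrite ?addnA ?mul1n ?dvdn_add//; last lia.
  by have := @bpE (m + n + m)%N; rewrite !addnA p3 => ->//; lia.
Qed.

Lemma corner_half_point (R : realType) (A m n X Y : nat) :
  (0 < m)%N -> (0 < n)%N ->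
  is_corner (half_table R A m n) (half_point R (X, Y)) ->
  (X = 0 \/ X = m)%N /\ (Y = 0 \/ Y = n)%N.
Proof.
move=> m0 n0 [t tc]; have [e [f [r [_ -> _ _]]]] := corner_half_table m0 n0 tc.
by move=> /half_point_inj[-> ->]; case: e f => [] [] /=; lia.
Qed.

Lemma on_vertical_side_half_point (R : realType) (A m n X Y : nat) :
  (Y <= n)%N -> on_vertical_side (half_table R A m n) (half_point R (X, Y)) =
  ((X == 0) || (X == m))%N.
Proof.
move=> Yn; rewrite /on_vertical_side width_half_table height_half_table /=.
rewrite divr_ge0 ?ler0n//= ler_pM2r ?invr_gt0 ?ltr0n// ler_nat Yn andbT.
by rewrite mulf_eq0 invr_eq0 !pnatr_eq0 orbF (inj_eq (mulIf _)) ?eqr_nat// invr_eq0 pnatr_eq0.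
Qed.

Lemma on_horizontal_side_half_point (R : realType) (A m n X Y : nat) :
  (X <= m)%N -> on_horizontal_side (half_table R A m n) (half_point R (X, Y)) =
  ((Y == 0) || (Y == n))%N.
Proof.
move=> Xm; rewrite /on_horizontal_side width_half_table height_half_table /=.
rewrite divr_ge0 ?ler0n//= ler_pM2r ?invr_gt0 ?ltr0n// ler_nat Xm /=.
by rewrite mulf_eq0 invr_eq0 !pnatr_eq0 orbF (inj_eq (mulIf _)) ?eqr_nat// invr_eq0 pnatr_eq0.
Qed.

(** Both coordinates move strictly monotonically between values in the closed ranges, so the open
    segment is interior. *)
Lemma hits_half_point (R : realType) (A m n k X Y X' Y' : nat) (e f : bool) :
  (0 < k)%N -> (X <= m)%N -> (Y <= n)%N -> (X' <= m)%N -> (Y' <= n)%N ->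
  (if e then X = X' + k else X' = X + k)%N ->
  (if f then Y = Y' + k else Y' = Y + k)%N ->
  [|| X' == 0, X' == m, Y' == 0 | Y' == n]%N ->
  hits (half_table R A m n) (half_point R (X, Y)) (heading R e f)
    (half_point R (X', Y')).
Proof.
move=> k0 Xm Yn X'm Y'n eX eY side.
have k0R : (0 : R) < k%:R by rewrite ltr0n.
have eXR : X'%:R = X%:R + (-1) ^+ e * k%:R :> R.
  by case: e eX => ->; rewrite natrD /=; ring.
have eYR : Y'%:R = Y%:R + (-1) ^+ f * k%:R :> R.
  by case: f eY => ->; rewrite natrD /=; ring.
move: Xm Yn X'm Y'n; rewrite -!(ler_nat R) => Xm Yn X'm Y'n.
have := (ler0n R X, ler0n R Y, ler0n R X', ler0n R Y') => -[[[X0 Y0] X'0] Y'0].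
exists (k%:R / 2); split.
- lra.
- by rewrite /move /half_point /=; congr pair; lra.
- rewrite /on_boundary on_vertical_side_half_point -?(ler_nat R)//.
  by rewrite on_horizontal_side_half_point -?(ler_nat R)// -orbA.
- move=> s /andP[s0 sk].
  rewrite /interior width_half_table height_half_table /=.
  move: eXR eYR; rewrite {eX eY}; case: e f => [] []; rewrite ?expr0 ?expr1 => eX eY;
    apply/andP; split; apply/andP; split; lra.
Qed.

(** * The unfolded trajectory and its bounces *)

Lemma divn_between (m s s' : nat) : (0 < m)%N ->
  (s %/ m * m <= s')%N -> (s' <= s)%N -> (s' %/ m = s %/ m)%N.
Proof.
move=> m0 le1 le2; apply/eqP; rewrite eqn_leq leq_div2r//=.
by rewrite leq_divRL.
Qed.

Lemma divn_pred (m s : nat) : (0 < m)%N -> (0 < s)%N ->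
  (s %/ m = s.-1 %/ m + (m %| s))%N.
Proof. by case: s => // s m0 _; rewrite divnS// addnC. Qed.

(** The block is that of [s.-1], not of [s], so that [s] may be the endpoint of the linear piece. *)
Lemma fold_step (m s s' : nat) (e : bool) : (0 < m)%N -> (s' < s)%N ->
  (s.-1 %/ m * m <= s')%N ->
  if odd (s' %/ m + e) then fold m e s' = (fold m e s + (s - s'))%N
  else fold m e s = (fold m e s' + (s - s'))%N.
Proof.
move=> m0 lts le1; have s0 : (0 < s)%N by apply: leq_ltn_trans lts.
have le2 : (s' <= s.-1)%N by rewrite -ltnS prednK.
rewrite (divn_between m0 le1 le2).
have := ltn_pmod s.-1 m0; have := divn_eq s.-1 m.
move: le1; set i := (s.-1 %/ m)%N; set r := (s.-1 %% m)%N => le1 sE rm.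
have -> : s = (i * m + r.+1)%N by lia.
have -> : s' = (i * m + (s' - i * m))%N by lia.
rewrite !fold_linear//; last lia.
case: odd; lia.
Qed.

(** Times at which the unfolded path meets a line of the grid formed by the reflected copies of the
    table. *)
Definition wall_time (m n s : nat) : bool := (m %| s)%N || (n %| s)%N.

Definition folded_point (R : realType) (m n : nat) (e f : bool) (s : nat) : R * R :=
  half_point R (fold m e s, fold n f s).

(** This is the outgoing velocity: at a wall time the quotient has already advanced, which includes
    the reflection. *)
Definition folded_heading (R : realType) (m n : nat) (e f : bool) (s : nat) : R * R :=
  heading R (odd (s %/ m + e)) (odd (s %/ n + f)).

Lemma fold_eq0m (m s : nat) (e : bool) : (0 < m)%N ->
  ((fold m e s == 0) || (fold m e s == m))%N = (m %| s)%N.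
Proof.
move=> m0; have [/dvdnP[k ->]|] := boolP (m %| s)%N.
  by rewrite fold_mul//; case: odd; rewrite ?mul1n ?mul0n eqxx ?orbT.
by move=> /(fold_ndvd e m0)/andP[]; lia.
Qed.

Lemma hits_folded_point (R : realType) (A m n s : nat) (e f : bool) :
  (0 < m)%N -> (0 < n)%N -> (0 < s)%N -> wall_time m n s ->
  exists s', [/\ (s' < s)%N, wall_time m n s',
    (s' %/ m = s.-1 %/ m)%N /\ (s' %/ n = s.-1 %/ n)%N
    & hits (half_table R A m n) (folded_point R m n e f s')
        (folded_heading R m n e f s') (folded_point R m n e f s)].
Proof.
move=> m0 n0 s0 ws.
(* The later of the last multiples of [m] and of [n] strictly before [s] is the preceding wall
   time. *)
exists (maxn (s.-1 %/ m * m) (s.-1 %/ n * n))%N; set s' := maxn _ _.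
have s'le : (s' <= s.-1)%N by rewrite geq_max !leq_divM.
have s'm : (s.-1 %/ m * m <= s')%N by rewrite leq_maxl.
have s'n : (s.-1 %/ n * n <= s')%N by rewrite leq_maxr.
have s'lt : (s' < s)%N by rewrite -(prednK s0) ltnS.
split=> //.
- by rewrite /wall_time /s' /maxn; case: ifP => _; apply/orP; [right|left]; exact: dvdn_mull.
- by split; apply: divn_between.
- apply: (@hits_half_point _ _ _ _ (s - s')); rewrite ?fold_le//.
  + by rewrite subn_gt0.
  + exact: fold_step.
  + exact: fold_step.
  + by rewrite orbA !fold_eq0m.
Qed.

Lemma bisector_half_point (R : realType) (m n : nat) (e f : bool) :
  (0 < m)%N -> (0 < n)%N ->
  bisector (half_point R (e * m, f * n)%N) = heading R e f.
Proof.
move=> m0 n0; rewrite /bisector /heading /= !mulf_eq0 invr_eq0 !pnatr_eq0 !orbF.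
by rewrite !muln_eq0; case: e f => [] [] /=; rewrite ?orbF ?(gtn_eqF m0) ?(gtn_eqF n0).
Qed.

Lemma ball_folded (R : realType) (A m n s : nat) (e f : bool) :
  (0 < m)%N -> (0 < n)%N -> coprime m n -> (s < m * n)%N -> wall_time m n s ->
  ball (half_table R A m n) (folded_point R m n e f 0)
    (folded_point R m n e f s) (folded_heading R m n e f s).
Proof.
move=> m0 n0 cop; have [k] := ubnP s; elim: k s => // k IH s sk s_lt ws.
have [->|s0] := posnP s.
  rewrite /folded_heading !div0n !add0n !oddb -(@bisector_half_point _ m n)//.
  by rewrite /folded_point !fold0; exact: ball_start.
have [s' [s's ws' [dm dn] hit]] := hits_folded_point R A e f m0 n0 s0 ws.
have bs' := IH s' (leq_trans s's sk) (ltn_trans s's s_lt) ws'.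
(* A corner would make the product [m * n] divide [s], by coprimality, although [0 < s < m * n]. *)
have ncorner : ~ ((m %| s)%N /\ (n %| s)%N).
  move=> /andP; rewrite -Gauss_dvd// => /(dvdn_leq s0); lia.
suff -> : folded_heading R m n e f s =
    reflect_velocity (half_table R A m n) (folded_point R m n e f s)
      (folded_heading R m n e f s').
  apply: ball_bounce bs' hit _ => /(corner_half_point m0 n0)[cX cY].
  apply: ncorner; rewrite -(fold_eq0m s e)// -(fold_eq0m s f)//.
  by split; apply/orP; [case: cX|case: cY] => ->; rewrite eqxx; auto.
rewrite /reflect_velocity on_vertical_side_half_point ?fold_le// fold_eq0m//.
(* Exactly one of [m] and [n] divides [s], so exactly one quotient increases and one velocity
   component changes sign. *)
rewrite /folded_heading /heading dm dn (divn_pred m0 s0) (divn_pred n0 s0).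
move: ws ncorner; rewrite /wall_time.
case: (m %| s)%N; case: (n %| s)%N => //= _ nc; first by case: nc.
- by rewrite !oddD !oddb addbT addbF addNb signrN.
- by rewrite !oddD !oddb addbT addbF addNb signrN.
Qed.

Lemma touches_folded (R : realType) (A m n s : nat) (e f : bool) :
  (0 < m)%N -> (0 < n)%N -> coprime m n -> (s <= m * n)%N -> wall_time m n s ->
  touches (half_table R A m n) (folded_point R m n e f 0)
    (folded_point R m n e f s).
Proof.
move=> m0 n0 cop s_le ws; have [->|s0] := posnP s; first by left.
have [s' [s's ws' _ hit]] := hits_folded_point R A e f m0 n0 s0 ws.
right; exists (folded_point R m n e f s'), (folded_heading R m n e f s').
by split=> //; apply: ball_folded => //; apply: leq_trans s_le.
Qed.

(** * The lattice that confines every path *)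

Definition on_grid (R : realType) (g : nat) (q : R * R) : Prop :=
  exists x y : int, q = (x%:~R * g%:R / 2, y%:~R * g%:R / 2).

Lemma on_grid_half_point (R : realType) (g X Y : nat) :
  on_grid g (half_point R (X, Y)) <-> (g %| X)%N /\ (g %| Y)%N.
Proof.
split=> [[x [y [eX eY]]]|[/dvdnP[x ->] /dvdnP[y ->]]].
  have dvd (Z : nat) (z : int) : Z%:R / 2 = z%:~R * g%:R / 2 :> R -> (g %| Z)%N.
    move=> eZ; suff : (g%:Z %| Z%:Z)%Z by [].
    apply/dvdzP; exists z; apply: (@intr_inj R).
    by rewrite intrM -!pmulrn; lra.
  by split; [exact: dvd eX|exact: dvd eY].
by exists x%:Z, y%:Z; rewrite /half_point /= !natrM -!pmulrn.
Qed.

(** The wall reached puts one coordinate on the lattice; this makes [t] a multiple of [g / 2], and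
    the other coordinate changes by [t] up to sign. *)
Lemma hits_on_grid (R : realType) (A m n g : nat) (p q : R * R) (e f : bool) :
  (g %| m)%N -> (g %| n)%N -> on_grid g p ->
  hits (half_table R A m n) p (heading R e f) q -> on_grid g q.
Proof.
move=> /dvdnP[m' ->] /dvdnP[n' ->] [x [y ->]] [t [_ -> + _]].
pose s (b : bool) : int := (-1) ^+ b.
have sR (b : bool) : (-1) ^+ b = (s b)%:~R :> R by rewrite /s rmorphXn /= rmorphN1.
have ss b : (s b)%:~R * (s b)%:~R = 1 :> R by rewrite -!sR -expr2 sqrr_sign.
have sx (X : int) : x%:~R * g%:R / 2 + t * (s e)%:~R = X%:~R * g%:R / 2 :> R ->
    on_grid g (move (x%:~R * g%:R / 2, y%:~R * g%:R / 2) (heading R e f) t).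
  move=> eX; exists X, (y + s f * s e * (X - x)).
  rewrite /move /heading /= !sR eX; congr pair.
  have -> : t = (s e)%:~R * (X%:~R * g%:R / 2 - x%:~R * g%:R / 2).
    by rewrite -eX addrAC subrr add0r mulrCA ss mulr1.
  by rewrite intrD !intrM intrB; field.
have sy (Y : int) : y%:~R * g%:R / 2 + t * (s f)%:~R = Y%:~R * g%:R / 2 :> R ->
    on_grid g (move (x%:~R * g%:R / 2, y%:~R * g%:R / 2) (heading R e f) t).
  move=> eY; exists (x + s e * s f * (Y - y)), Y.
  rewrite /move /heading /= !sR eY; congr pair.
  have -> : t = (s f)%:~R * (Y%:~R * g%:R / 2 - y%:~R * g%:R / 2).
    by rewrite -eY addrAC subrr add0r mulrCA ss mulr1.
  by rewrite intrD !intrM intrB; field.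
rewrite /on_boundary /on_vertical_side /on_horizontal_side.
rewrite width_half_table height_half_table /= !sR !natrM.
case/orP => /andP[].
- by case/orP => /eqP eX _; [apply: (sx 0)|apply: (sx m'%:Z)]; rewrite eX ?mul0r.
- by move=> _ /orP[]/eqP eY; [apply: (sy 0)|apply: (sy n'%:Z)]; rewrite eY ?mul0r.
Qed.

Lemma ball_on_grid (R : realType) (A m n g : nat) (u p v : R * R) :
  (g %| m)%N -> (g %| n)%N -> on_grid g u -> ball (half_table R A m n) u p v ->
  on_grid g p /\ exists e f : bool, v = heading R e f.
Proof.
move=> gm gn gu; elim=> {p v} [|p v q _ [gp [e [f ->]]] hit _].
  split=> //; exists (u.1 != 0), (u.2 != 0).
  by rewrite /bisector /heading; do 2!case: eqP.
split; first exact: hits_on_grid hit.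
rewrite /reflect_velocity; case: ifP => _; [exists (~~ e), f|exists e, (~~ f)];
  by rewrite /heading /= signrN.
Qed.

Lemma touches_on_grid (R : realType) (A m n g : nat) (u q : R * R) :
  (g %| m)%N -> (g %| n)%N -> on_grid g u ->
  touches (half_table R A m n) u q -> on_grid g q.
Proof.
move=> gm gn gu [->//|[p [v [bp hit]]]].
have [gp [e [f vE]]] := ball_on_grid gm gn gu bp.
by move: hit; rewrite vE; exact: hits_on_grid.
Qed.

(** * Parity of the pockets and the equivalence *)

Lemma half_int (R : realType) (Z : nat) :
  (Z%:R / 2 \is a @Num.int R) = ~~ odd Z.
Proof.
apply/idP/idP => [/intrP[k kE]|evenZ].
  have : Z%:Z = 2 * k by apply: (@intr_inj R); rewrite intrM -pmulrn -kE; lra.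
  lia.
apply/intrP; exists Z./2%:Z.
by rewrite -{1}(even_halfK evenZ) -muln2 natrM -pmulrn; lra.
Qed.

Theorem mainTheorem3 (R : realType) (A B C D : nat)
    (A_gt0 : (0 < A)%N) (ltAB : (A < B)%N) (ltBC : (B < C)%N) (ltCD : (C < D)%N)
    (eqCADB : (C - A = D - B)%N) (a b c d : R)
    (def_a : a = A%:R / 2) (def_b : b = B%:R / 2)
    (def_c : c = C%:R / 2) (def_d : d = D%:R / 2)
    (two_pockets : count (fun t : R => t \is a Num.int) [:: a; b; c; d] = 2%N)
    (u : R * R) (pocket_u : pocket (Table a b c d) u) :
  (forall q : R * R,
     integer_point (Table a b c d) q -> touches (Table a b c d) u q)
  <-> coprime (B - A) (C - B).
Proof.
have [m0 n0] : (0 < B - A)%N /\ (0 < C - B)%N by lia.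
have [BE CE DE] : [/\ B = A + (B - A), C = A + (B - A) + (C - B)
    & D = A + (B - A) + (C - B) + (B - A)]%N by split; lia.
move: (B - A)%N (C - B)%N m0 n0 BE CE DE => m n m0 n0 BE CE DE.
have TE : Table a b c d = half_table R A m n.
  by rewrite /half_table -DE -CE -BE def_a def_b def_c def_d.
rewrite TE in pocket_u *.
(* If [m] and [n] were both even, all four corners would have the parity of [A], giving 0 or 4
   pockets. *)
have g_odd : odd (gcdn m n).
  apply/negPn/negP; rewrite -dvdn2 dvdn_gcd !dvdn2 => /andP[m_even n_even].
  move: two_pockets; rewrite def_a def_b def_c def_d /= !half_int BE CE DE !oddD.
  by rewrite (negbTE m_even) (negbTE n_even) !addbF; case: odd.
case: pocket_u => t [t_corner t_int ->].
have [e [f [r0 [tE -> r0_odd r0_dvd]]]] := corner_half_table m0 n0 t_corner.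
have perimeter_gt0 : (0 < 2 * (m + n))%N by lia.
have rem_lt (z : int) :
    (absz ((z - A%:Z) %% (2 * (m + n))%:Z)%Z < 2 * (m + n))%N by lia.
have remE (z : int) : (absz ((z - A%:Z) %% (2 * (m + n))%:Z)%Z)%:Z =
    ((z - A%:Z) %% (2 * (m + n))%:Z)%Z.
  by rewrite gez0_abs// modz_ge0//; lia.
have intE (k : int) : k%:~R = (2 * k)%:~R / 2 :> R by rewrite intrM; lra.
split=> [touch|cop q [k ->]].
- have /intrP[k kE] := t_int.
  have gu : on_grid (gcdn m n) (half_point R (e * m, f * n)%N).
    by rewrite on_grid_half_point !dvdn_mull ?dvdn_gcdl ?dvdn_gcdr.
  have k2 : 2 * k = A%:Z + r0%:Z.
    by apply: (@intr_inj R); rewrite intrM intrD -!pmulrn -kE tE natrD; lra.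
  have [|] := touches_on_grid (dvdn_gcdl m n) (dvdn_gcdr m n) gu
    (touch (boundary_point (half_table R A m n) (k + 1)%:~R) _).
    by exists (k + 1).
  move=> x [y]; rewrite intE boundary_point_half//.
  set r := absz _ => rE; have r_lt : (r < 2 * (m + n))%N by exact: rem_lt.
  have [g1 g2] : (gcdn m n %| (perimeter_point m n r).1)%N /\
      (gcdn m n %| (perimeter_point m n r).2)%N.
    by apply/(on_grid_half_point R); rewrite -surjective_pairing; exists x, y.
  have gr := dvdn_perimeter_point (ltnW r_lt) (dvdn_gcdl m n) (dvdn_gcdr m n) g1 g2.
  have gr0 := r0_dvd _ (dvdn_gcdl m n) (dvdn_gcdr m n).
  have g2mn : (gcdn m n %| 2 * (m + n))%N.
    by rewrite dvdn_mull// dvdn_add ?dvdn_gcdl ?dvdn_gcdr.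
  (* [r] is [r0 + 2] modulo the doubled perimeter, itself a multiple of the gcd. *)
  have r2E : r0%:Z + 2 = r%:Z +
      ((2 * (k + 1) - A%:Z) %/ (2 * (m + n))%:Z)%Z * (2 * (m + n))%:Z.
    have -> : r0%:Z + 2 = 2 * (k + 1) - A%:Z by rewrite mulrDr k2; ring.
    by rewrite remE [RHS]addrC -divz_eq.
  have : ((gcdn m n)%:Z %| r0%:Z + 2)%Z by rewrite r2E rpredD// dvdz_mull.
  rewrite rpredDl// => g_dvd2.
  have : (gcdn m n %| 2)%N by [].
  rewrite /coprime; move: g_odd; by case: (gcdn m n) => [|[|[|g]]].
- rewrite intE boundary_point_half//.
  set r := absz _; have r_lt : (r < 2 * (m + n))%N by exact: rem_lt.
  (* The modulus [2 * (m + n)] is even, so [r] has the parity of [A]; since the start is a pocket,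
     [A + r0] is even. *)
  have r_odd : odd r = odd (e * m + f * n).
    have : odd r = odd A.
      have := divz_eq (2 * k - A%:Z) (2 * (m + n))%:Z; rewrite -remE -/r PoszM.
      by move: (_ %/ _)%Z => l; clear; lia.
    move: t_int; rewrite tE half_int oddD r0_odd => tev ->.
    by apply/eqP; rewrite -[_ == _]negbK negb_eqb.
  have [Xm Yn] := perimeter_point_le (ltnW r_lt).
  have par := odd_perimeter_point (ltnW r_lt); rewrite r_odd in par.
  have [s s_le [sX sY]] := fold_chinese m0 n0 cop Xm Yn par.
  have := @touches_folded R A m n s e f m0 n0 cop s_le.
  rewrite /folded_point !fold0 sX sY -surjective_pairing; apply.
  (* The target lies on a side, hence its arrival time is a wall time. *)
  rewrite /wall_time -(fold_eq0m s e)// -(fold_eq0m s f)// sX sY -orbA.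
  exact: perimeter_point_side.
Qed.
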